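(* For any integer $t\geq 2$, we have $$px_3(K_{2,t})=\begin{cases}2 & \text{if } 2\leq t\leq 4;\\ 3 & \text{if } 5\leq t\leq 18;\\ \left\lceil\sqrt{\tfrac{t}{2}}\,\right\rceil & \text{if } t\geq 19.\end{cases}$$
   Context: All graphs are simple, finite, undirected and connected. $K_{s,t}$ denotes the complete bipartite graph with partite sets of sizes $s$ and $t$. An edge-coloring of a graph $G$ is any map $c:E(G)\to\{1,\dots,m\}$, $m\in\mathbb{N}$ (adjacent edges may receive the same color). A tree $T$ that is a subgraph of an edge-colored graph $G$ is a proper tree if no two adjacent edges of $T$ are assigned the same color. For $S\subseteq V(G)$, an $S$-tree is a tree that is a subgraph of $G$ and contains all vertices of $S$. For a connected graph $G$ of order $n$ and an integer $k$ with $2\le k\le n$, a $k$-proper coloring of $G$ is an edge-coloring such that for every set $S$ of $k$ vertices of $G$ there exists a proper $S$-tree in $G$. The $k$-proper index $px_k(G)$ is the minimum number of colors required in a $k$-proper coloring of $G$. *)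

(* Defs.v *)
From mathcomp Require Import all_boot all_order all_algebra.
From mathcomp Require Import reals.

Set Implicit Arguments.
Unset Strict Implicit.
Unset Printing Implicit Defensive.

Record sgraph := SGraph {
  vertex : finType;
  adj : rel vertex;
  adj_sym : symmetric adj;
  adj_irr : irreflexive adj
}.

Definition edges (G : sgraph) : {set {set vertex G}} :=
  [set [set p.1; p.2] | p : vertex G * vertex G & adj p.1 p.2].

Definition Kbip_adj (s t : nat) : rel ('I_s + 'I_t) :=
  fun x y => is_inl x != is_inl y.

Lemma Kbip_adj_sym s t : symmetric (@Kbip_adj s t).
Proof. by move=> x y; rewrite /Kbip_adj eq_sym. Qed.

Lemma Kbip_adj_irr s t : irreflexive (@Kbip_adj s t).
Proof. by move=> x; rewrite /Kbip_adj eqxx. Qed.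

Definition Kbip (s t : nat) : sgraph :=
  SGraph (@Kbip_adj_sym s t) (@Kbip_adj_irr s t).

Section Coloring.

Variable G : sgraph.
Implicit Types (W S : {set vertex G}) (F : {set {set vertex G}}).

(* A subgraph of G is a pair (W, F) of a vertex set and an edge set. *)
Definition is_subgraph W F : Prop :=
  F \subset edges G /\ forall e, e \in F -> e \subset W.

Definition edge_rel F : rel (vertex G) := fun x y => [set x; y] \in F.

Definition connected_sub W F : Prop :=
  W != set0 /\ {in W &, forall x y, connect (edge_rel F) x y}.

(* [ucycle] also accepts the empty, one-vertex and two-vertex (x, y, x) closed
   walks without repeated vertex; the cycles of a graph have length >= 3. *)
Definition acyclic_sub F : Prop :=
  forall p : seq (vertex G), ucycle (edge_rel F) p -> size p < 3.

Definition is_tree W F : Prop :=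
  [/\ is_subgraph W F, connected_sub W F & acyclic_sub F].

Definition is_Stree S W F : Prop := is_tree W F /\ S \subset W.

(* An edge-coloring with colors 1, ..., m is represented by a total function on
   sets of vertices, of which only the values on the edges of G matter. *)
Definition is_edge_coloring (m : nat) (c : {set vertex G} -> nat) : Prop :=
  forall e, e \in edges G -> 1 <= c e <= m.

Definition edge_adjacent (e f : {set vertex G}) : bool :=
  (e != f) && (e :&: f != set0).

Definition is_proper (c : {set vertex G} -> nat) F : Prop :=
  {in F &, forall e f, edge_adjacent e f -> c e <> c f}.

Definition is_k_proper_coloring (k m : nat) (c : {set vertex G} -> nat) : Prop :=
  is_edge_coloring m c /\
  forall S, #|S| = k -> exists W F, is_Stree S W F /\ is_proper c F.

(* px_k(G) = m, i.e. m is the minimum number of colors. *)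
Definition is_proper_index (k m : nat) : Prop :=
  (exists c, is_k_proper_coloring k m c) /\
  (forall m' c, is_k_proper_coloring k m' c -> m <= m').

End Coloring.

(* Main.v *)
(* Give the i-th vertex of the part of size t the code (a_i, b_i) of the colors
   of its two edges. A proper tree containing both vertices u, v of the other
   part consists of one connector w joined to both, of vertices joined to u with
   distinct a-colors and of vertices joined to v with distinct b-colors.

   Lower bounds: three vertices with the same code lie in no proper tree, so
   t <= 2 m^2. With two colors a proper tree is a path with at most three
   vertices of the part of size t, and among any five codes some triple admits
   no such path.

   Upper bounds: for m >= 3, if every code occurs at most twice and the six codes
   off the diagonal of {1,2,3}^2 all occur, then for any three vertices with two
   distinct a-colors (or b-colors) one of these six codes provides the
   connector. Fewer than six vertices are handled by explicit colorings. *)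
Require Import Defs.
From mathcomp Require Import all_boot all_order all_algebra.
From mathcomp Require Import reals.
From mathcomp Require Import zify.

Set Implicit Arguments.
Unset Strict Implicit.
Unset Printing Implicit Defensive.

(** * Sequences and closed walks *)

Lemma map_uniq_inj_in (T1 T2 : eqType) (f : T1 -> T2) (s : seq T1) :
  uniq (map f s) -> {in s &, injective f}.
Proof.
elim: s => //= x s IH /andP[fx us] y z; rewrite !inE.
case/predU1P => [->|ys] /predU1P[->|zs] // E; last exact: IH E.
- by rewrite E map_f in fx.
- by rewrite -E map_f in fx.
Qed.

(** Once the cycle is rotated to start at [x], its second and last vertices are the neighbours;
    length at least 3 makes them distinct. *)
Lemma ucycle_two_neighbours (T : eqType) (e : rel T) (p : seq T) (x : T) :
  ucycle e p -> 2 < size p -> x \in p ->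
  exists y z, [/\ y \in p, z \in p, y != z, e x y & e z x].
Proof.
move=> cp sp xp.
have [i q defq] := rot_to xp.
have memq y : (y \in p) = (y \in x :: q) by rewrite -defq mem_rot.
have sq : 1 < size q.
  by move: sp; rewrite -(size_rot i) defq.
have : ucycle e (rot i p) by rewrite rot_ucycle.
rewrite defq; case: q sq {defq} memq => [|y q] //= sq memq.
case/andP=> /=; rewrite rcons_path => /and3P[exy _ ezx] /and3P[_ yq _].
exists y, (last y q); split=> //.
- by rewrite memq !inE eqxx orbT.
- by rewrite memq in_cons mem_last orbT.
- by case: q sq yq {memq ezx} => //= z q _ yq; apply: contraNneq yq => ->; exact: mem_last.
Qed.

(** * Edges of $K_{2,t}$ and colorings given by codes *)

Section RightVertices.

Variable t : nat.
Let G := Kbip 2 t.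

Definition left (s : 'I_2) : vertex G := inl s.
Definition right (i : 'I_t) : vertex G := inr i.
Definition bip_edge (s : 'I_2) (i : 'I_t) : {set vertex G} := [set left s; right i].

Lemma left_in_edge s s' i : (left s \in bip_edge s' i) = (s == s').
Proof. by rewrite !inE orbF. Qed.

Lemma right_in_edge i s j : (right i \in bip_edge s j) = (i == j).
Proof. by rewrite !inE. Qed.

Lemma bip_edge_inj s i s' i' : bip_edge s i = bip_edge s' i' -> s = s' /\ i = i'.
Proof.
move=> E; split; apply/eqP.
- by rewrite -(left_in_edge s s' i') -E left_in_edge.
- by rewrite -(right_in_edge i s' i') -E right_in_edge.
Qed.

Lemma bip_edgeP e : reflect (exists s i, e = bip_edge s i) (e \in edges G).
Proof.
apply: (iffP imsetP) => [[[x y] /=] | [s [i ->]]].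
- rewrite inE /= /Kbip_adj; case: x y => [s|i] [s'|i'] //= _ ->.
  + by exists s, i'.
  + by exists s', i; rewrite setUC.
- by exists (left s, right i); rewrite ?inE.
Qed.

(** An edge has exactly one right vertex, so the choice made by [pick] is forced there; 0 is a
    default for sets without right vertex, which are not edges. *)
Definition codes_coloring (a b : nat -> nat) (e : {set vertex G}) : nat :=
  if [pick i | right i \in e] is Some i
  then if left ord0 \in e then a i else b i else 0.

Lemma codes_coloringE a b s i :
  codes_coloring a b (bip_edge s i) = if s == ord0 then a i else b i.
Proof.
rewrite /codes_coloring; case: pickP => [j|/(_ i)]; rewrite right_in_edge ?eqxx //.
by move=> /eqP->; rewrite left_in_edge eq_sym.
Qed.

End RightVertices.

(* The tree in K_{2,t} in which w is joined to both left vertices, A to the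
   first one and B to the second one is proper and contains T. *)
Definition spanned (a b : nat -> nat) (t : nat) (T : seq nat) : Prop :=
  exists w A B, [/\ w < t,
    [&& a w != b w, uniq (map a (w :: A)) & uniq (map b (w :: B))],
    ~~ has (mem A) B & {subset T <= w :: A ++ B}].

(** * The proper tree with a single connector *)

Section ProperTree.

Variables (t : nat) (a b : nat -> nat) (w : nat) (A B : seq nat).
Hypotheses (wt : w < t) (abw : a w != b w).
Hypotheses (uA : uniq (map a (w :: A))) (uB : uniq (map b (w :: B))).
Hypothesis AB : ~~ has (mem A) B.

(** The neighbours in the tree of the left vertex [s]. *)
Let N (s : 'I_2) : seq nat := if s == ord0 then w :: A else w :: B.
Let w' : 'I_t := Ordinal wt.

Definition tree_edges : {set {set vertex (Kbip 2 t)}} :=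
  [set e | [exists s, exists i : 'I_t, (val i \in N s) && (e == bip_edge s i)]].

Definition tree_vertices : {set vertex (Kbip 2 t)} :=
  [set x | if x is inr i then val i \in w :: A ++ B else true].

Lemma right_tree_vertices i : (right i \in tree_vertices) = (val i \in w :: A ++ B).
Proof. by rewrite inE. Qed.

Lemma left_tree_vertices s : left t s \in tree_vertices.
Proof. by rewrite inE. Qed.

Lemma ord2_cases (s : 'I_2) : s = ord0 \/ s = ord_max.
Proof. by case: s => -[|[|//]] ?; [left|right]; apply: val_inj. Qed.

Lemma tree_edgesP e :
  reflect (exists s i, val i \in N s /\ e = bip_edge s i) (e \in tree_edges).
Proof.
rewrite inE; apply: (iffP existsP) => [[s /existsP[i /andP[? /eqP]]]|[s [i [? ->]]]].
- by exists s, i.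
- by exists s; apply/existsP; exists i; rewrite eqxx andbT.
Qed.

Lemma mem_tree_edges s i : (bip_edge s i \in tree_edges) = (val i \in N s).
Proof.
apply/tree_edgesP/idP => [[s' [i' [Ns' /bip_edge_inj[-> ->]]]] //|Ns].
by exists s, i.
Qed.

Lemma memN_both s s' i : s != s' -> i \in N s -> i \in N s' -> i = w.
Proof.
rewrite /N; case: (ord2_cases s) => ->; case: (ord2_cases s') => -> //= _;
  rewrite !inE => /predU1P[//|iA] /predU1P[//|iB]; move/negP: AB; case; apply/hasP;
  by exists i.
Qed.

Lemma edge_rel_tree_left s y : edge_rel tree_edges (left t s) y ->
  exists2 i : 'I_t, val i \in N s & y = right i.
Proof.
case: y => [s'|i] /= e.
  have [s1 [i1 [_ E]]] := tree_edgesP _ e.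
  by have := right_in_edge i1 s1 i1; rewrite -E eqxx !inE.
by exists i; rewrite // -mem_tree_edges.
Qed.

Lemma edge_rel_tree_right i y : edge_rel tree_edges (right i) y ->
  exists2 s, val i \in N s & y = left t s.
Proof.
case: y => [s|i'] /= e.
  by exists s; rewrite // -mem_tree_edges /bip_edge setUC.
have [s1 [i1 [_ E]]] := tree_edgesP _ e.
by have := left_in_edge s1 s1 i1; rewrite -E eqxx !inE.
Qed.

Lemma edge_rel_sym F : symmetric (@edge_rel (Kbip 2 t) F).
Proof. by move=> x y; rewrite /edge_rel setUC. Qed.

Lemma tree_acyclic : acyclic_sub tree_edges.
Proof.
move=> p cp; rewrite ltnNge; apply/negP => sp.
(* A right vertex on a cycle has two neighbours, so it is w. *)
have right_w i : right i \in p -> val i = w.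
  move=> ip; have [y [z [_ _ yz]]] := ucycle_two_neighbours cp sp ip.
  case/edge_rel_tree_right => s Ns ys.
  rewrite edge_rel_sym => /edge_rel_tree_right[s' Ns' zs].
  by apply: memN_both Ns Ns'; apply: contraNneq yz => E; rewrite ys zs E.
(* The two distinct cycle neighbours of a left vertex are right vertices, hence would both be
   [w]. *)
have no_left s : left t s \notin p.
  apply/negP => xp; have [y [z [yp zp yz]]] := ucycle_two_neighbours cp sp xp.
  case/edge_rel_tree_left => i _ yi.
  rewrite edge_rel_sym => /edge_rel_tree_left[i' _ zi].
  case/eqP: yz; rewrite yi zi in yp zp *; congr right; apply: val_inj.
  by rewrite (right_w _ yp) (right_w _ zp).
case: p cp sp right_w no_left => // x p cp sp _ no_left.
have [y [z [yp _ _ exy _]]] := ucycle_two_neighbours cp sp (mem_head x p).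
case: x {cp sp} no_left exy yp => [s|i] no_left exy yp.
  by have := no_left s; rewrite mem_head.
have [s _ ys] := edge_rel_tree_right exy.
by have := no_left s; rewrite -ys yp.
Qed.

(** Edges meeting at a left vertex are separated by [uA] or [uB]; distinct edges meeting at a right
    vertex meet at [w], where [abw] applies. *)
Lemma tree_proper : is_proper (codes_coloring a b) tree_edges.
Proof.
move=> _ _ /tree_edgesP[s [i [Ni ->]]] /tree_edgesP[s' [i' [Ni' ->]]].
case/andP => /eqP ne /set0Pn[x]; rewrite inE !codes_coloringE.
case: x => [s1|i1] /andP[].
- rewrite !left_in_edge => /eqP-> /eqP ss' {s1}; rewrite -ss' in Ni' ne *.
  have ii' : val i <> val i' by move=> /val_inj E; apply: ne; rewrite E.
  move: Ni Ni'; rewrite /N; case: ifP => _ Ni Ni' E; apply: ii'.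
  + exact: (map_uniq_inj_in uA).
  + exact: (map_uniq_inj_in uB).
- rewrite !right_in_edge => /eqP-> /eqP ii' {i1}; rewrite -ii' in Ni' ne *.
  have ss' : s != s' by apply: contra_notN ne => /eqP->.
  have -> : nat_of_ord i = w by exact: (memN_both ss' Ni Ni').
  move: ss'; case: (ord2_cases s) => ->; case: (ord2_cases s') => -> //= _.
  + exact/eqP.
  + exact/nesym/eqP.
Qed.

Lemma tree_is_tree : is_tree tree_vertices tree_edges.
Proof.
have wN s : w \in N s by rewrite /N; case: ifP => _; exact: mem_head.
split; [split| |exact: tree_acyclic].
- by apply/subsetP => e /tree_edgesP[s [i [_ ->]]]; apply/bip_edgeP; exists s, i.
- move=> e /tree_edgesP[s [i [Ni ->]]]; apply/subsetP => x.
  rewrite in_set2 => /orP[] /eqP->; first exact: left_tree_vertices.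
  rewrite right_tree_vertices; move: Ni; rewrite /N !inE mem_cat.
  by case: ifP => _; rewrite inE => /orP[->|->]; rewrite ?orbT.
split; first by apply/set0Pn; exists (left t ord0); exact: left_tree_vertices.
(* Connectedness: every vertex is joined to [w], a right one through a left neighbour. *)
have to_w x : x \in tree_vertices -> connect (edge_rel tree_edges) x (right w').
  have left_w s : connect (edge_rel tree_edges) (left t s) (right w').
    by apply: connect1; rewrite /edge_rel mem_tree_edges.
  case: x => [s|i]; first by rewrite left_w.
  rewrite right_tree_vertices => iw.
  have [s Ni] : exists s, val i \in N s.
    move: iw; rewrite inE mem_cat => /or3P[/eqP E|iA|iB].
    + by exists ord0; rewrite E.
    + by exists ord0; rewrite /N eqxx inE iA orbT.
    + by exists ord_max; rewrite /N /= inE iB orbT.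
  apply: connect_trans (left_w s); apply: connect1.
  by rewrite edge_rel_sym /edge_rel mem_tree_edges.
move=> x y xW yW; apply: connect_trans (to_w _ xW) _.
by rewrite (sym_connect_sym (@edge_rel_sym _)) ; apply: to_w.
Qed.

End ProperTree.

Lemma spanned_coloring t m (a b : nat -> nat) :
  0 < t -> (forall i, i < t -> (1 <= a i <= m) && (1 <= b i <= m)) ->
  (forall i j k, i < t -> j < t -> k < t -> spanned a b t [:: i; j; k]) ->
  is_k_proper_coloring 3 m (@codes_coloring t a b).
Proof.
move=> t0 ab sp; split.
  move=> e /bip_edgeP[s [i ->]]; rewrite codes_coloringE.
  by have /andP[] := ab i (ltn_ord i); case: ifP.
move=> S; rewrite cardE => S3.
(* Every tree built above contains both left vertices, so a left vertex of [S] may be replaced by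
   right vertex 0. The three indices may then coincide. *)
pose f (x : vertex (Kbip 2 t)) := if x is inr i then i else Ordinal t0.
have memS x : (x \in S) = (x \in enum S) by rewrite mem_enum.
case: (enum S) S3 memS => [|x [|y [|z []]]] //= _ memS.
have [w [A [B [wt /and3P[abw uA uB] AB sub]]]] :=
  sp _ _ _ (ltn_ord (f x)) (ltn_ord (f y)) (ltn_ord (f z)).
exists (tree_vertices t w A B), (tree_edges t w A B); split; last exact: tree_proper.
split; first exact: tree_is_tree.
apply/subsetP => -[s|i]; first by rewrite left_tree_vertices.
rewrite right_tree_vertices memS !inE => iS; apply: sub; rewrite !inE.
by case/or3P: iS => /eqP<- /=; rewrite eqxx ?orbT.
Qed.

(** * Triples spanned through a connector *)

Lemma spanned_swap a b t T : spanned a b t T -> spanned b a t T.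
Proof.
case=> w [A [B [wt /and3P[ab uA uB] AB sub]]]; exists w, B, A; split=> //.
- by rewrite eq_sym ab uA uB.
- by rewrite has_sym.
- by move=> x /sub; rewrite !inE !mem_cat [(x \in A) || _]orbC.
Qed.

Lemma sub_spanned a b t T T' :
  {subset T <= T'} -> spanned a b t T' -> spanned a b t T.
Proof.
move=> TT' [w [A [B [wt ab AB sub]]]]; exists w, A, B; split=> // x xT.
exact/sub/TT'.
Qed.

(** The vertex [k] becomes a leaf at the second left vertex, unless it already lies in [A]; the
    filter keeps the two lists of leaves disjoint. *)
Lemma spanned_cons a b t w A k :
  w < t -> a w != b w -> uniq (map a (w :: A)) -> b w != b k ->
  spanned a b t (k :: A).
Proof.
move=> wt ab uA bk; exists w, A, [seq x <- [:: k] | x \notin A]; split=> //.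
- by rewrite ab uA /=; case: ifP; rewrite //= inE bk.
- by apply/hasPn => x; rewrite mem_filter => /andP[].
- move=> x; rewrite !in_cons mem_cat mem_filter inE.
  by case: (x \in A); case: (x == k); rewrite /= ?orbT.
Qed.

(** What a connector must avoid in order to carry two leaves, of [a]-colors [x] and [y], at the
    first left vertex and one leaf, of [b]-color [z], at the second. *)
Definition has_connectors (a b : nat -> nat) (t : nat) : Prop :=
  forall x y z, exists w, [/\ w < t, a w != b w & [&& a w != x, a w != y & b w != z]].

Lemma spanned_neq a b t i j k :
  has_connectors a b t -> a i != a j -> spanned a b t [:: k; i; j].
Proof.
move=> conn aij; have [w [wt ab /and3P[wi wj wk]]] := conn (a i) (a j) (b k).
by apply: spanned_cons wt ab _ wk; rewrite /= !inE negb_or wi wj aij.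
Qed.

Lemma spanned_pair a b t i k : has_connectors a b t -> spanned a b t [:: k; i].
Proof.
move=> conn; have [w [wt ab /and3P[wi _ wk]]] := conn (a i) (a i) (b k).
by apply: spanned_cons wt ab _ wk; rewrite /= inE wi.
Qed.

Definition code_multiplicity_le2 (a b : nat -> nat) (t : nat) : Prop :=
  forall i j k, i < t -> j < t -> k < t -> a i = a j -> a j = a k ->
    b i = b j -> b j = b k -> [|| i == j, j == k | i == k].

(** If two [a]-colors or two [b]-colors differ, those two vertices hang at the corresponding left
    vertex and the third at the other. Otherwise all codes agree, two indices coincide, and a pair
    remains. *)
Lemma spanned_triple a b t i j k :
  has_connectors a b t -> has_connectors b a t -> code_multiplicity_le2 a b t ->
  i < t -> j < t -> k < t -> spanned a b t [:: i; j; k].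
Proof.
move=> cab cba mult it jt kt.
have [aij|/(spanned_neq k cab)] := eqVneq (a i) (a j); last first.
  by apply: sub_spanned => x; rewrite !inE => /or3P[]->; rewrite ?orbT.
have [ajk|/(spanned_neq i cab)//] := eqVneq (a j) (a k).
have [bij|/(spanned_neq k cba)/spanned_swap] := eqVneq (b i) (b j); last first.
  by apply: sub_spanned => x; rewrite !inE => /or3P[]->; rewrite ?orbT.
have [bjk|/(spanned_neq i cba)/spanned_swap//] := eqVneq (b j) (b k).
case/or3P: (mult _ _ _ it jt kt aij ajk bij bjk) => /eqP->;
  [apply: sub_spanned (spanned_pair k j cab)|apply: sub_spanned (spanned_pair k i cab)
  |apply: sub_spanned (spanned_pair k j cab)];
  by move=> x; rewrite !inE => /or3P[]->; rewrite ?orbT.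
Qed.

(** * Codes over three or more colors *)

Definition off_diagonal3 : seq (nat * nat) :=
  [:: (1, 2); (2, 1); (1, 3); (3, 1); (2, 3); (3, 2)].

(** Avoiding [x] and [y] leaves at least one of the colors 1, 2, 3; the two codes with that color in
    the given coordinate differ in the other one, so one of them avoids [z]. *)
Lemma off_diagonal3_connector x y z :
  has (fun p => [&& p.1 != x, p.1 != y & p.2 != z]) off_diagonal3 /\
  has (fun p => [&& p.2 != x, p.2 != y & p.1 != z]) off_diagonal3.
Proof.
by case: x => [|[|[|[|x]]]]; case: y => [|[|[|[|y]]]]; case: z => [|[|[|[|z]]]].
Qed.

Definition all_codes (m : nat) : seq (nat * nat) :=
  [seq (x, y) | x <- iota 1 m, y <- iota 1 m].

Lemma mem_all_codes m p : (p \in all_codes m) = (1 <= p.1 <= m) && (1 <= p.2 <= m).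
Proof.
apply/allpairsP/idP => [[[x y] /= [+ + ->]]|/andP[p1 p2]].
  by rewrite !mem_iota !add1n !ltnS => -> ->.
by exists p; rewrite !mem_iota !add1n !ltnS -surjective_pairing p1 p2.
Qed.

Lemma uniq_all_codes m : uniq (all_codes m).
Proof. by rewrite allpairs_uniq ?iota_uniq // => -[? ?] []. Qed.

(** The six off-diagonal codes come first, so that six right vertices suffice for all of them to
    occur. *)
Definition codes (m : nat) : seq (nat * nat) :=
  off_diagonal3 ++ [seq p <- all_codes m | p \notin off_diagonal3].

Definition code (m i : nat) : nat * nat := nth (1, 1) (codes m) (i %% m ^ 2).

Section ThreeColors.

Variable m : nat.
Hypothesis m3 : 3 <= m.

Lemma mem_codes p : (p \in codes m) = (p \in all_codes m).
Proof.
rewrite mem_cat mem_filter; have [|//] := boolP (p \in off_diagonal3).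
by rewrite mem_all_codes !inE => /orP[|/or4P[|||/orP[]]] /eqP-> /=; lia.
Qed.

Lemma uniq_codes : uniq (codes m).
Proof.
rewrite cat_uniq filter_uniq ?uniq_all_codes // andbT.
by apply/hasPn => p; rewrite mem_filter => /andP[].
Qed.

Lemma size_codes : size (codes m) = m ^ 2.
Proof.
have -> : m ^ 2 = size (all_codes m) by rewrite size_allpairs size_iota.
by apply/eqP; rewrite -uniq_size_uniq ?uniq_codes ?uniq_all_codes //; move=> p; rewrite mem_codes.
Qed.

Let m2 : 0 < m ^ 2. Proof. by rewrite expn_gt0 (leq_trans _ m3). Qed.

Lemma code_range i :
  (1 <= (code m i).1 <= m) && (1 <= (code m i).2 <= m).
Proof. by rewrite -mem_all_codes -mem_codes mem_nth // size_codes ltn_mod. Qed.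

(** Equal codes force equal residues modulo [m ^ 2], and below [2 * m ^ 2] the quotient takes only
    two values, so two of three indices agree. *)
Lemma code_multiplicity t : t <= 2 * m ^ 2 ->
  code_multiplicity_le2 (fun i => (code m i).1) (fun i => (code m i).2) t.
Proof.
move=> tm i j k it jt kt a1 a2 b1 b2.
have inj x y : (code m x).1 = (code m y).1 -> (code m x).2 = (code m y).2 ->
    x = y %[mod m ^ 2].
  move=> e1 e2; apply/eqP; rewrite -(nth_uniq (1, 1) _ _ uniq_codes) ?size_codes ?ltn_mod //.
  apply/eqP; rewrite -/(code m x) -/(code m y) (surjective_pairing (code m x)) e1 e2.
  by rewrite -surjective_pairing.
have := inj _ _ a1 b1; have := inj _ _ a2 b2.
have q x : x < t -> x %/ m ^ 2 < 2 by move=> xt; rewrite ltn_divLR //; lia.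
have := q _ it; have := q _ jt; have := q _ kt.
have := divn_eq i (m ^ 2); have := divn_eq j (m ^ 2); have := divn_eq k (m ^ 2).
move: (i %/ _) (j %/ _) (k %/ _) (i %% _) (j %% _) (k %% _) => u v w r r' r''.
by case: u => [|[|//]]; case: v => [|[|//]]; case: w => [|[|//]] *; lia.
Qed.

Lemma code_connectors t : 6 <= t ->
  has_connectors (fun i => (code m i).1) (fun i => (code m i).2) t /\
  has_connectors (fun i => (code m i).2) (fun i => (code m i).1) t.
Proof.
move=> t6.
have six_codes P : has P off_diagonal3 -> exists w,
    [/\ w < t, P (code m w) & (code m w).1 != (code m w).2].
  case/(has_nthP (1, 1)) => w w6 Pw; exists w.
  have -> : code m w = nth (1, 1) off_diagonal3 w.
    rewrite /code modn_small ?nth_cat ?w6 //.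
    (* The first six indices are not reduced, since 6 <= 3^2 <= m^2. *)
    by apply: leq_trans w6 _; apply: (@leq_trans (3 ^ 2)); rewrite // leq_exp2r.
  split=> //; first exact: leq_trans t6.
  by move: w w6 {Pw}; do 6 case=> //.
split=> x y z; have [h1 h2] := off_diagonal3_connector x y z.
- by have [w [? ? ?]] := six_codes _ h1; exists w.
- by have [w [? ? ?]] := six_codes _ h2; exists w; rewrite eq_sym.
Qed.

End ThreeColors.

Lemma large_coloring m t : 3 <= m -> 6 <= t -> t <= 2 * m ^ 2 ->
  exists c, @is_k_proper_coloring (Kbip 2 t) 3 m c.
Proof.
move=> m3 t6 tm; eexists; apply: spanned_coloring; first exact: leq_trans t6.
  by move=> i _; exact: (code_range m3 i).
have [c1 c2] := code_connectors m3 t6.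
by move=> i j k; apply: (spanned_triple c1 c2); exact: code_multiplicity.
Qed.

(** * Explicit colorings for at most five right vertices *)

(** A search for the witnesses of [spanned] in which [A] and [B] range over the subsequences of the
    triple; [masks] lists the eight bit masks of length 3. *)
Definition spannedb (a b : nat -> nat) (t : nat) : bool :=
  let masks := iter 3 (fun s => map (cons true) s ++ map (cons false) s) [:: [::]] in
  all (fun i => all (fun j => all (fun k => has (fun w => has (fun A => has (fun B =>
    [&& [&& a w != b w, uniq (map a (w :: A)) & uniq (map b (w :: B))],
        ~~ has (mem A) B & all (mem (w :: A ++ B)) [:: i; j; k]])
    [seq mask s [:: i; j; k] | s <- masks]) [seq mask s [:: i; j; k] | s <- masks])
    (iota 0 t)) (iota 0 t)) (iota 0 t)) (iota 0 t).

Lemma spannedbP a b t i j k : spannedb a b t -> i < t -> j < t -> k < t ->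
  spanned a b t [:: i; j; k].
Proof.
have mem_t n : (n \in iota 0 t) = (n < t) by rewrite mem_iota.
move=> + it jt kt; move/allP/(_ i); rewrite mem_t => /(_ it).
move/allP/(_ j); rewrite mem_t => /(_ jt).
move/allP/(_ k); rewrite mem_t => /(_ kt).
case/hasP => w; rewrite mem_t => wt /hasP[A _] /hasP[B _] /and3P[ab AB /allP sub].
by exists w, A, B.
Qed.

Lemma small_coloring t : 2 <= t <= 4 ->
  exists c, @is_k_proper_coloring (Kbip 2 t) 3 2 c.
Proof.
(* The codes (1, 2) and (2, 1) alternate, so that each occurs at most twice. *)
move=> t24; pose a i := (odd i).+1; pose b i := (~~ odd i).+1.
exists (codes_coloring a b); apply: spanned_coloring; first by case/andP: t24 => /ltnW.
  by move=> i _; rewrite /a /b; case: (odd i).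
move=> i j k; apply: spannedbP.
by case: t t24 => [|[|[|[|[|]]]]] // _; vm_compute.
Qed.

Lemma five_coloring : exists c, @is_k_proper_coloring (Kbip 2 5) 3 3 c.
Proof.
(* These are the first five codes of [off_diagonal3]. *)
exists (codes_coloring (nth 0 [:: 1; 2; 1; 3; 2]) (nth 0 [:: 2; 1; 3; 1; 3])).
apply: spanned_coloring => // [i|i j k]; first by do 5 case: i => [|i] //.
by apply: spannedbP; vm_compute.
Qed.

(** * Lower bounds on the number of colors *)

Section LowerBounds.

Variables (t m : nat) (c : {set vertex (Kbip 2 t)} -> nat).
Hypothesis cP : is_k_proper_coloring 3 m c.

Lemma color_range s i : 1 <= c (bip_edge s i) <= m.
Proof. by apply: (proj1 cP); apply/bip_edgeP; exists s, i. Qed.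

Section InTree.

Variables (S W : {set vertex (Kbip 2 t)}) (F : {set {set vertex (Kbip 2 t)}}).
Hypotheses (tree : is_Stree S W F) (proper : is_proper c F).

Lemma proper_left s i j : bip_edge s i \in F -> bip_edge s j \in F -> i != j ->
  c (bip_edge s i) <> c (bip_edge s j).
Proof.
move=> Fi Fj ij; apply: proper => //; apply/andP; split.
  by apply: contraNneq ij => /bip_edge_inj[_ ->].
by apply/set0Pn; exists (left t s); rewrite inE !left_in_edge eqxx.
Qed.

Lemma proper_right s s' i : bip_edge s i \in F -> bip_edge s' i \in F -> s != s' ->
  c (bip_edge s i) <> c (bip_edge s' i).
Proof.
move=> Fi Fj ij; apply: proper => //; apply/andP; split.
  by apply: contraNneq ij => /bip_edge_inj[->].
by apply/set0Pn; exists (right i); rewrite inE !right_in_edge eqxx.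
Qed.

Lemma edge_rel_right i y : edge_rel F (right i) y ->
  exists2 s, bip_edge s i \in F & y = left t s.
Proof.
case: tree => -[[/subsetP FE _] _ _] _; rewrite /edge_rel => e.
have [s [j E]] := bip_edgeP _ (FE _ e).
case: y E e => [s'|i'] E e; first by exists s'; rewrite // /bip_edge setUC.
by have := left_in_edge s s j; rewrite -E eqxx !inE.
Qed.

Lemma edge_rel_left s y : edge_rel F (left t s) y ->
  exists2 i, bip_edge s i \in F & y = right i.
Proof.
case: tree => -[[/subsetP FE _] _ _] _; rewrite /edge_rel => e.
have [s' [j E]] := bip_edgeP _ (FE _ e).
case: y E e => [s1|i] E e; last by exists i.
by have := right_in_edge j s' j; rewrite -E eqxx !inE.
Qed.

Lemma tree_connect x y : x \in S -> y \in S -> connect (edge_rel F) x y.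
Proof.
by case: tree => -[_ [_ conn] _] /subsetP SW xS yS; apply: conn; exact: SW.
Qed.

(** The first step of a tree path from [right i] to another vertex is such an edge. *)
Lemma right_has_edge i x : right i \in S -> x \in S -> x != right i ->
  exists s, bip_edge s i \in F.
Proof.
move=> iS xS xi; have /connectP[p] := tree_connect iS xS.
case: p => [_ /= E|y p /= /andP[/edge_rel_right[s Fs _] _] _]; last by exists s.
by rewrite E eqxx in xi.
Qed.

(* Otherwise s and its tree neighbours would be closed under tree edges. *)
Lemma tree_connector s s' i j : right i \in S -> right j \in S ->
  bip_edge s i \in F -> bip_edge s' j \in F -> s != s' ->
  exists w, forall r, bip_edge r w \in F.
Proof.
move=> iS jS Fi Fj ss'.
pose nbhd : pred (vertex (Kbip 2 t)) :=
  fun x => match x with inl r => r == s | inr k => bip_edge s k \in F end.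
have other_side r : r != s -> r = s'.
  by case: (ord2_cases r) (ord2_cases s) (ord2_cases s') ss' => -> [] -> [] ->.
have both k : bip_edge s k \in F -> bip_edge s' k \in F ->
    exists w, forall r, bip_edge r w \in F.
  by move=> Fk Fk'; exists k => r; have [->|/other_side->] := eqVneq r s.
case: (boolP [exists k, (bip_edge s k \in F) && (bip_edge s' k \in F)]).
  by case/existsP=> k /andP[]; exact: both.
rewrite negb_exists => /forallP no_both.
have closed_nbhd : closed (edge_rel F) nbhd.
  apply: intro_closed; first exact: sym_connect_sym (edge_rel_sym F).
  move=> [r|k] y e; rewrite unfold_in /= => xX.
  - by have [k Fk ->] := edge_rel_left e; rewrite unfold_in /= -(eqP xX).
  - have [r Fk ->] := edge_rel_right e; rewrite unfold_in /=.
    have := no_both k; rewrite xX /=; apply: contraNT => /other_side<-.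
    exact: Fk.
have := closed_connect closed_nbhd (tree_connect iS jS).
by rewrite !unfold_in /= Fi => /esym Fj'; exact: both Fj' Fj.
Qed.

End InTree.

Lemma three_vertex_tree (x y z : vertex (Kbip 2 t)) : uniq [:: x; y; z] ->
  exists S W F, [/\ is_Stree S W F, is_proper c F, x \in S, y \in S & z \in S].
Proof.
move=> xyz; pose S := [set v in [:: x; y; z]].
have S3 : #|S| = 3 by rewrite cardsE (card_uniqP xyz).
have [W [F [tree proper]]] := (proj2 cP) S S3.
by exists S, W, F; rewrite !inE !eqxx !orbT.
Qed.

Lemma three_right_tree i j k : uniq [:: i; j; k] ->
  exists S W F, [/\ is_Stree S W F, is_proper c F &
    {in [:: i; j; k], forall x, right x \in S /\ exists s, bip_edge s x \in F}].
Proof.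
move=> ijk; have [|S [W [F [tree proper iS jS kS]]]] :=
  @three_vertex_tree (right i) (right j) (right k).
  by rewrite -(map_inj_uniq (f := @right t)) // in ijk => ? ? [].
exists S, W, F; split=> // x; move: ijk; rewrite /= !inE negb_or andbT.
case/andP=> /andP[ij ik] jk /or3P[] /eqP->; split=> //.
- by apply: (right_has_edge tree iS jS); apply: contraNneq ij => -[->].
- by apply: (right_has_edge tree jS kS); apply: contraNneq jk => -[->].
- by apply: (right_has_edge tree kS iS); apply: contraNneq ik => -[->].
Qed.

(** Each of the three vertices has a tree edge to one of only two left vertices, so two of these
    edges share a left vertex and a color. *)
Lemma equal_codes i j k : uniq [:: i; j; k] ->
  (forall s, c (bip_edge s i) = c (bip_edge s j)) ->
  (forall s, c (bip_edge s j) = c (bip_edge s k)) -> False.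
Proof.
move=> ijk eij ejk; have [S [W [F [_ proper F_]]]] := three_right_tree ijk.
have [_ [r Fi]] : _ := F_ i (mem_head _ _).
have [_ [r' Fj]] : _ := F_ j ltac:(by rewrite !inE eqxx orbT).
have [_ [r'' Fk]] : _ := F_ k ltac:(by rewrite !inE eqxx !orbT).
move: ijk; rewrite /= !inE negb_or andbT => /andP[/andP[ij ik] jk].
have [E|rr'] := eqVneq r r'.
  by rewrite -E in Fj; apply: (proper_left proper Fi Fj ij); exact: eij.
have [E|rr''] := eqVneq r r''.
  by rewrite -E in Fk; apply: (proper_left proper Fi Fk ik); rewrite eij.
have E : r' = r''.
  by move: rr' rr''; case: (ord2_cases r) (ord2_cases r') (ord2_cases r'') => -> [] -> [] ->.
by rewrite -E in Fk; apply: (proper_left proper Fj Fk jk).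
Qed.

(** Two right vertices in a tree either hang at a common left vertex or give a connector; both
    produce adjacent edges, impossible with one color. *)
Lemma two_colors_needed : 2 <= t -> 2 <= m.
Proof.
move=> t2; rewrite ltnNge; apply/negP => m1.
have same s s' i j : c (bip_edge s i) = c (bip_edge s' j).
  by have := color_range s i; have := color_range s' j; lia.
have [i [j ij]] : exists i j : 'I_t, i != j.
  by exists (Ordinal (ltnW t2)), (Ordinal t2).
(* The third vertex is a left one because there may be only two right vertices. *)
have [|S [W [F [tree proper iS jS _]]]] :=
  @three_vertex_tree (right i) (right j) (left t ord0).
  by rewrite /= !inE !negb_or /= !andbT; apply: contraNneq ij => -[->].
have ijn : right i != right j by apply: contraNneq ij => -[->].
have [r Fi] := right_has_edge tree iS jS ltac:(by rewrite eq_sym).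
have [r' Fj] := right_has_edge tree jS iS ijn.
have [E|rr'] := eqVneq r r'.
  by rewrite -E in Fj; apply: (proper_left proper Fi Fj ij).
have [w Fw] := tree_connector tree iS jS Fi Fj rr'.
by apply: (proper_right proper (Fw ord0) (Fw ord_max)).
Qed.

(** The right vertices are partitioned by code into [m ^ 2] classes, each of size at most 2 by
    [equal_codes]. *)
Lemma order_bound : 2 <= t -> t <= 2 * m ^ 2.
Proof.
move=> t2; have m2 := two_colors_needed t2.
(* Colors 1, ..., m are shifted to 0, ..., m - 1; the form [m.-1.+1] is what [inord] requires. *)
pose col s i : 'I_m.-1.+1 := inord (c (bip_edge s i)).-1.
have col_inj s i j : col s i = col s j -> c (bip_edge s i) = c (bip_edge s j).
  move/(congr1 (@nat_of_ord _)); have := color_range s i; have := color_range s j.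
  move=> jm im; rewrite !inordK; lia.
have fibre p : \sum_(i | (col ord0 i, col ord_max i) == p) 1 <= 2.
  rewrite sum1_card leqNgt; apply/negP => /card_gt2P[i [j [k [[+ + +] [ij jk ki]]]]].
  rewrite !unfold_in /= => /andP[/eqP i0 /eqP i1] /andP[/eqP j0 /eqP j1] /andP[/eqP k0 /eqP k1].
  apply: (@equal_codes i j k) => [|s|s].
  - by rewrite /= !inE negb_or ij jk eq_sym ki.
  - by apply: col_inj; case: (ord2_cases s) => ->; rewrite ?i0 ?i1.
  - by apply: col_inj; case: (ord2_cases s) => ->; rewrite ?j0 ?j1.
rewrite -{1}[t]card_ord -sum1_card (partition_big (fun i => (col ord0 i, col ord_max i)) predT) //=.
apply: leq_trans (leq_sum _ (fun p _ => fibre p)) _.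
by rewrite sum_nat_const card_prod !card_ord prednK ?(ltnW m2) // mulnC mulnn.
Qed.

(** * Two colors do not suffice for five right vertices *)

(** Properness of the path x, u, y, v, z, with u and v the left vertices; a Boolean records whether
    a color is 1. *)
Definition middle (x y z : bool * bool) : bool :=
  [&& x.1 != y.1, y.1 != y.2 & y.2 != z.2].

Definition path_colored (x y z : bool * bool) : bool :=
  [|| middle x y z, middle z y x, middle y x z, middle z x y, middle x z y | middle y z x].

Definition is_one s i : bool := c (bip_edge s i) == 1.

(** With two colors a left vertex has at most two tree edges, so the connector must be one of the
    three vertices, and the other two hang at different left vertices. *)
Lemma two_colors_path i j k : m <= 2 -> uniq [:: i; j; k] ->
  path_colored (is_one ord0 i, is_one ord_max i) (is_one ord0 j, is_one ord_max j)
               (is_one ord0 k, is_one ord_max k).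
Proof.
move=> m2 ijk; have [S [W [F [tree proper F_]]]] := three_right_tree ijk.
have bool_neq s s' x y : c (bip_edge s x) <> c (bip_edge s' y) ->
    is_one s x != is_one s' y.
  by rewrite /is_one; have := color_range s x; have := color_range s' y; lia.
have at_left s x y : bip_edge s x \in F -> bip_edge s y \in F -> x != y ->
    is_one s x != is_one s y.
  by move=> Fx Fy xy; apply: bool_neq; exact: (proper_left proper).
have no3 s x y z : bip_edge s x \in F -> bip_edge s y \in F -> bip_edge s z \in F ->
    x != y -> y != z -> x != z -> False.
  move=> Fx Fy Fz xy yz xz; have := at_left _ _ _ Fx Fy xy.
  have := at_left _ _ _ Fy Fz yz; have := at_left _ _ _ Fx Fz xz.
  by case: is_one; case: is_one; case: is_one.
have mid w x y r r' : (forall s, bip_edge s w \in F) -> bip_edge r x \in F ->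
    bip_edge r' y \in F -> x != w -> y != w -> x != y ->
    let p z := (is_one ord0 z, is_one ord_max z) in
    middle (p x) (p w) (p y) || middle (p y) (p w) (p x).
  move=> Fw Fx Fy xw yw xy; rewrite /middle /=.
  have ww : is_one ord0 w != is_one ord_max w by apply: bool_neq; exact: (proper_right proper).
  rewrite ww /=.
  case: (ord2_cases r) (ord2_cases r') Fx Fy => -> [] -> Fx Fy.
  - by case: (no3 _ _ _ _ Fx (Fw _) Fy); rewrite // eq_sym.
  - by rewrite (at_left _ _ _ Fx) // (at_left _ _ _ (Fw _) Fy) // eq_sym.
  - by rewrite (at_left _ _ _ Fy) // (at_left _ _ _ (Fw _) Fx) ?orbT // eq_sym.
  - by case: (no3 _ _ _ _ Fx (Fw _) Fy); rewrite // eq_sym.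
have [iS [r Fi]] : _ := F_ i (mem_head _ _).
have [jS [r' Fj]] : _ := F_ j ltac:(by rewrite !inE eqxx orbT).
have [kS [r'' Fk]] : _ := F_ k ltac:(by rewrite !inE eqxx !orbT).
move: ijk; rewrite /= !inE negb_or andbT => /andP[/andP[ij ik] jk].
(* Without a connector all three vertices would hang at the same left vertex, against [no3]. *)
have [w Fw] : exists w, forall s, bip_edge s w \in F.
  have [E|/(tree_connector tree iS jS Fi Fj)//] := eqVneq r r'.
  have [E'|/(tree_connector tree iS kS Fi Fk)//] := eqVneq r r''.
  by rewrite -E in Fj; rewrite -E' in Fk; case: (no3 _ _ _ _ Fi Fj Fk).
have [ji ki kj] : [/\ j != i, k != i & k != j] by split; rewrite eq_sym.
rewrite /path_colored.
have [wi|wi] := eqVneq w i.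
  rewrite wi in Fw.
  by have /orP[->|->] := mid _ _ _ _ _ Fw Fj Fk ji ki jk; rewrite ?orbT.
have [wj|wj] := eqVneq w j.
  rewrite wj in Fw.
  by have /orP[->|->] := mid _ _ _ _ _ Fw Fi Fk ij kj ik; rewrite ?orbT.
have [wk|wk] := eqVneq w k.
  rewrite wk in Fw.
  by have /orP[->|->] := mid _ _ _ _ _ Fw Fi Fj ik jk ij; rewrite ?orbT.
(* Here [w] is none of the three: two of them share a left vertex, where the edge to [w] is a third
   one. *)
have [E|rr'] := eqVneq r r'.
  by rewrite -E in Fj; case: (no3 _ _ _ _ (Fw _) Fi Fj).
have [E|rr''] := eqVneq r r''.
  by rewrite -E in Fk; case: (no3 _ _ _ _ (Fw _) Fi Fk).
have E : r' = r''.
  by move: rr' rr''; case: (ord2_cases r) (ord2_cases r') (ord2_cases r'') => -> [] -> [] ->.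
by rewrite -E in Fk; case: (no3 _ _ _ _ (Fw _) Fj Fk).
Qed.

(** Exhaustion of the 4^5 assignments of codes to five vertices. *)
Lemma no_five_path_colored (x0 x1 x2 x3 x4 : bool * bool) :
  ~~ [&& path_colored x0 x1 x2, path_colored x0 x1 x3, path_colored x0 x1 x4,
         path_colored x0 x2 x3, path_colored x0 x2 x4, path_colored x0 x3 x4,
         path_colored x1 x2 x3, path_colored x1 x2 x4, path_colored x1 x3 x4
       & path_colored x2 x3 x4].
Proof.
by case: x0 x1 x2 x3 x4 => [[] []] [[] []] [[] []] [[] []] [[] []].
Qed.

(** The first five right vertices, embedded by [widen_ord], already contradict
    [no_five_path_colored]. *)
Lemma three_colors_needed : 5 <= t -> 3 <= m.
Proof.
move=> t5; rewrite ltnNge; apply/negP => m2.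
have pathP (i j k : 'I_5) : uniq [:: i; j; k] ->
    let p x := (is_one ord0 (widen_ord t5 x), is_one ord_max (widen_ord t5 x)) in
    path_colored (p i) (p j) (p k).
  have inj : injective (widen_ord t5) by move=> x y [/val_inj].
  rewrite -(map_inj_uniq inj) /=; exact: two_colors_path.
pose o n : 'I_5 := inord n.
have ouniq a b d : uniq [:: a; b; d] -> all (fun n => n < 5) [:: a; b; d] ->
    uniq [:: o a; o b; o d].
  by move=> + /and4P[a5 b5 d5 _]; rewrite /= !inE -!val_eqE /= !inordK.
pose p x := (is_one ord0 (widen_ord t5 (o x)), is_one ord_max (widen_ord t5 (o x))).
by case/negP: (no_five_path_colored (p 0) (p 1) (p 2) (p 3) (p 4));
   do !(apply/andP; split); apply: pathP; apply: ouniq.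
Qed.

End LowerBounds.

(** * The ceiling formula and the three ranges of t *)

Import Order.TTheory GRing.Theory Num.Theory.

(** This makes the ceiling the least m with t <= 2 m^2. The absolute value only converts a
    nonnegative integer to a natural number. *)
Lemma ceil_sqrt_half_le (R : realType) (t m : nat) :
  (`|Num.ceil (Num.sqrt (t%:R / 2%:R : R)%R)|%N <= m) = (t <= 2 * m ^ 2).
Proof.
set x := Num.sqrt _.
have x0 : (0 <= x)%R by exact: sqrtr_ge0.
have -> : (`|Num.ceil x|%N <= m) = (Num.ceil x <= m%:Z)%R.
  by rewrite -lez_nat gez0_abs // ceil_ge0 (lt_le_trans _ x0) // ltrN10.
rewrite ceil_le_int -pmulrn /x -[X in (_ <= X)%R]ger0_norm ?ler0n // -sqrtr_sqr.
rewrite ler_sqrt ?exprn_ge0 ?ler0n // ler_pdivrMr ?ltr0n //.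
by rewrite -natrX -natrM ler_nat mulnC.
Qed.

(** Minimality is reduced to arithmetic: the number of colors of any 3-proper coloring meets the
    three lower bounds. *)
Lemma proper_index_Kbip2 t m : 2 <= t ->
  (exists c, @is_k_proper_coloring (Kbip 2 t) 3 m c) ->
  (forall m', 2 <= m' -> (5 <= t -> 3 <= m') -> t <= 2 * m' ^ 2 -> m <= m') ->
  is_proper_index (Kbip 2 t) 3 m.
Proof.
move=> t2 ex_c min_m; split=> // m' c cP; apply: min_m.
- exact: two_colors_needed cP t2.
- exact: three_colors_needed cP.
- exact: order_bound cP t2.
Qed.

Theorem theorem3 (R : realType) (t : nat) (ht : 2 <= t) :
  is_proper_index (Kbip 2 t) 3
    (if t <= 4 then 2
     else if t <= 18 then 3
     else `|Num.ceil (Num.sqrt (t%:R / 2%:R : R)%R)|%N).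
Proof.
have [t4|t5] := leqP t 4.
  by apply: proper_index_Kbip2 => //; apply: small_coloring; rewrite ht.
have [t18|t19] := leqP t 18.
  apply: proper_index_Kbip2 => // [|m' _ ->] //.
  (* Here 18 = 2 * 3^2 is the bound for three colors; t = 5 is apart, having too few vertices for
     the six off-diagonal codes. *)
  have [t6|] := leqP 6 t; first exact: large_coloring.
  by rewrite ltnS => t5'; have -> : t = 5 by [lia]; exact: five_coloring.
have le_m := ceil_sqrt_half_le R t.
apply: proper_index_Kbip2 => // [|m' _ _]; last by rewrite le_m.
apply: large_coloring; last by rewrite -le_m.
(* At least three colors, since t > 18 exceeds 2 * 2^2 = 8. *)
- rewrite ltnNge le_m -ltnNge; exact: leq_trans t19.
- exact: leq_trans t19.
Qed.
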